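(* Let $X$ be a dendroid that has at least one point $p$ such that $\{p\}$ is not a shore set of $X$. Then $\Lambda_X=\mathcal{CNB}(\mathcal F_1(X))$; that is, the family of sets $\pi(a)$, $a\in X$, coincides with the family of connected nonblockers of $X$.
   Context: A continuum is a nonempty compact connected metric space. A continuum $X$ is unicoherent if $A\cap B$ is connected whenever $A,B$ are subcontinua with $A\cup B=X$; it is hereditarily unicoherent if each of its subcontinua is unicoherent. A dendroid is an arcwise connected hereditarily unicoherent continuum. $2^X$ is the space of all nonempty closed subsets of $X$ with the Hausdorff metric $\mathcal H$, and $\mathcal C(X)\subset 2^X$ is the subspace of connected ones. A set $A\in 2^X\setminus\{X\}$ is a shore set of $X$ if for each $\epsilon>0$ there is $B\in\mathcal C(X)$ with $\mathcal H(B,X)<\epsilon$ and $B\cap A=\emptyset$. An order arc is a continuous map $\alpha:[0,1]\to 2^X$ such that $\alpha(s)\subsetneq\alpha(t)$ whenever $0\le s<t\le 1$. A nonblocker of $X$ is a set $A\in 2^X\setminus\{X\}$ such that for every $x\in X\setminus A$ there is an order arc $\alpha:[0,1]\to \mathcal C(X)$ with $\alpha(0)=\{x\}$, $\alpha(1)=X$ and $\alpha(t)\cap A=\emptyset$ for all $t\in[0,1)$. $\mathcal{CNB}(\mathcal F_1(X))$ is the set of all connected nonblockers of $X$. For $a\in X$, $\pi(a)$ is the intersection of all nonblockers of $X$ containing $a$ if at least one exists, and $\pi(a)=X$ otherwise; $\Lambda_X=\{\pi(a):a\in X\}$.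
   Formalization: The formal conclusion is that Λ_X equals the family of connected nonblockers together with X itself: if {p} is not a shore set then π(p)=X always lies in Λ_X, whereas X is by definition not a nonblocker (e.g. X=[0,1]). *)

(* Defs.v *)
From HB Require Import structures.
From mathcomp Require Import all_boot all_order all_algebra.
From mathcomp Require Import all_classical all_reals all_analysis.
Import Order.TTheory GRing.Theory Num.Theory.
Import numFieldTopology.Exports.

Set Implicit Arguments.
Unset Strict Implicit.
Unset Printing Implicit Defensive.

Local Open Scope classical_set_scope.
Local Open Scope ring_scope.

Section Continua.
Context {R : realType} {T : metricType R}.
Implicit Types (A B C X Y : set T) (x y a : T).

Definition continuum X : Prop := [/\ X !=set0, compact X & connected X].

Definition unicoherent X : Prop :=
  forall A B, continuum A -> continuum B -> A `|` B = X -> connected (A `&` B).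

Definition hereditarily_unicoherent X : Prop :=
  forall Y, Y `<=` X -> continuum Y -> unicoherent Y.

(* [A] is homeomorphic to the unit interval, by a homeomorphism taking the end
   points to [x] and [y]; [g] is its inverse. *)
Definition arc_between x y A : Prop :=
  exists (f : R -> T) (g : T -> R),
    [/\ {within `[0, 1], continuous f} /\ {within A, continuous g},
        f @` `[0, 1] = A,
        {in `[0, 1], cancel f g},
        f 0 = x & f 1 = y].

Definition arcwise_connected X : Prop :=
  forall x y, X x -> X y -> x <> y -> exists2 A, arc_between x y A & A `<=` X.

Definition dendroid X : Prop :=
  [/\ continuum X, arcwise_connected X & hereditarily_unicoherent X].

Definition neighborhood (e : R) A : set T := \bigcup_(a in A) ball a e.

Definition hausdorff_dist A B : R :=
  inf [set e : R | [/\ 0 < e, A `<=` neighborhood e B & B `<=` neighborhood e A]].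

(* From here on the continuum X of the text is the whole space [T]. *)

(* 2^X *)
Definition hyperspace : set (set T) := [set A | A !=set0 /\ closed A].

(* C(X) *)
Definition connected_hyperspace : set (set T) :=
  [set A | hyperspace A /\ connected A].

Definition shore_set A : Prop :=
  [/\ hyperspace A, A <> setT &
      forall e : R, 0 < e ->
        exists B, [/\ connected_hyperspace B, hausdorff_dist B setT < e &
                      B `&` A = set0]].

(* Maps from [0,1] are total functions on [R], constrained only on [0,1]; the
   second clause is continuity for the Hausdorff metric. *)
Definition order_arc (alpha : R -> set T) : Prop :=
  [/\ forall t, t \in `[0, 1] -> hyperspace (alpha t),
      forall s, s \in `[0, 1] ->
        hausdorff_dist (alpha t) (alpha s) @[t --> within `[0, 1] (nbhs s)]
          --> (0 : R) &
      forall s t, 0 <= s -> s < t -> t <= 1 -> alpha s `<` alpha t].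

Definition nonblocker A : Prop :=
  [/\ hyperspace A, A <> setT &
      forall x, ~ A x ->
        exists alpha : R -> set T,
          [/\ order_arc alpha,
              forall t, t \in `[0, 1] -> connected_hyperspace (alpha t),
              alpha 0 = [set x], alpha 1 = setT &
              forall t, t \in `[0, 1[ -> alpha t `&` A = set0]].

Definition nb_hull a : set T :=
  if `[< exists A, nonblocker A /\ A a >]
  then \bigcap_(A in [set A | nonblocker A /\ A a]) A
  else setT.

End Continua.

Section Families.
Context {R : realType} (T : metricType R).

Definition CNB : set (set T) := [set A | nonblocker A /\ connected A].

Definition Lambda : set (set T) := range (@nb_hull R T).

End Families.

Arguments CNB {R} T _.
Arguments Lambda {R} T _.

(* Main.v *)
(* Let p be a point such that {p} is not a shore set.  If A is a nonblocker and
   x is not in A, the continua of an order arc from {x} to X that avoids A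
   approximate X, so one of them contains p: every point outside A is joined to
   p by a continuum missing A, and in particular p is not in A, so pi(p) = X.

   If A is also connected, let a be the first point of A on an arc from p.  A
   nonblocker B containing a but missing some z in A would give a continuum K
   through p and z missing B; hereditary unicoherence, applied to A and to the
   union of K and the arc from p to a, would make the disjoint union of K /\ A
   and {a} connected.  So pi(a) = A.

   Conversely pi(a), if proper, is a nonblocker, and so is its component C at a:
   by unicoherence an arc from a point x of pi(a) \ C to p misses C, and it can
   be prolonged by an order arc from {p} that misses pi(a).  By minimality
   pi(a) = C is connected. *)
Require Import Defs.
From HB Require Import structures.
From mathcomp Require Import all_boot all_order all_algebra.
From mathcomp Require Import all_classical all_reals all_analysis.
From mathcomp Require Import lra.
Import Order.TTheory GRing.Theory Num.Theory.
Import numFieldNormedType.Exports.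

Set Implicit Arguments.
Unset Strict Implicit.
Unset Printing Implicit Defensive.

Local Open Scope classical_set_scope.
Local Open Scope ring_scope.

(** * Hausdorff distance and a Whitney map on a compact metric space *)

Section CompactMetric.
Context {R : realType} {T : metricType R}.
Implicit Types (A B C : set T) (x y a : T).

Lemma mdist_ballP x (e : R) y : ball x e y <-> mdist x y < e.
Proof. by rewrite ballEmdist. Qed.

Lemma compact_totally_bounded (e : R) : compact [set: T] -> 0 < e ->
  exists s : seq T, forall y, exists2 x, x \in s & ball x e y.
Proof.
(* The covering form of compactness is stated for pointed types, so a base point is chosen first; an
   empty space is settled by the empty list. *)
have [[x0]|T0] := pselect (inhabited T); last by exists [::] => y; case: T0.
pose Tp : ptopologicalType := HB.pack T (isPointed.Build T x0).
rewrite (compact_cover Tp) => cT e0.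
have [|y _|s _ sT] := cT T setT (fun x => (ball x e)°).
- by move=> x _; exact: open_interior.
- by exists y => //; rewrite /interior; exact: nbhsx_ballx.
exists (finmap.enum_fset s) => y; have [x xs xy] := sT y I; exists x => //.
exact: interior_subset xy.
Qed.

Lemma compact_dense_sequence (x0 : T) : compact [set: T] ->
  exists u : nat -> T, forall y (e : R), 0 < e -> exists n, ball y e (u n).
Proof.
move=> cT.
have /choice[s sP] (n : nat) : exists s : seq T,
    forall y, exists2 x, x \in s & ball x (n.+1%:R^-1 : R) y.
  by apply: compact_totally_bounded.
(* The index [k] codes a pair: a mesh [n] and a position in the net of mesh [1/(n+1)]. The default
   values only repeat points of [T], so density is unaffected. *)
exists (fun k => let p := odflt (0%N, 0%N) (unpickle k) in nth x0 (s p.1) p.2).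
move=> y e e0.
have [n _ /(_ _ (leqnn n)) ne] := near_infty_natSinv_lt (PosNum e0).
have [x xs xy] := sP n y.
exists (pickle (n, index x (s n))); rewrite pickleK /= nth_index//.
by apply/ball_sym; apply: le_ball xy; exact: ltW.
Qed.

Lemma compact_mdist_bounded : compact [set: T] ->
  exists2 M : R, 0 < M & forall x y, mdist x y < M.
Proof.
move=> cT; have [s sP] := compact_totally_bounded cT (@ltr01 R).
have [/eqP s0|] := boolP (s == [::]).
  by exists 1 => // x; have [z] := sP x; rewrite s0 in_nil.
case: s sP => // x0 s sP _.
set u := x0 :: s in sP.
(* The sum of the distances from [x0] to the net stands in for their maximum. *)
have M0 : 0 <= \sum_(x <- u) mdist x0 x by apply: sumr_ge0 => *; exact: mdist_ge0.
have Mx x : mdist x0 x < \sum_(x <- u) mdist x0 x + 1.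
  have [z zu /mdist_ballP zx] := sP x.
  apply: le_lt_trans (metric_triangle _ z _) _; apply: ler_ltD => //.
  rewrite (big_rem z)//= lerDl; apply: sumr_ge0 => *; exact: mdist_ge0.
exists (\sum_(x <- u) mdist x0 x + 1 + (\sum_(x <- u) mdist x0 x + 1)).
  by move: M0; lra.
move=> x y; apply: le_lt_trans (metric_triangle _ x0 _) _.
by apply: ltrD => //; rewrite metric_sym.
Qed.

(** The relation under the infimum in [hausdorff_dist]; estimates made on it avoid handling that
    infimum. *)
Definition hclose (e : R) A B := A `<=` neighborhood e B /\ B `<=` neighborhood e A.

Lemma hclose_sym (e : R) A B : hclose e A B -> hclose e B A.
Proof. by case. Qed.

Lemma hcloseU (e : R) C A B : 0 < e -> hclose e A B -> hclose e (C `|` A) (C `|` B).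
Proof.
move=> e0 [AB BA]; split=> x [Cx|].
- by exists x; [left|exact: ballxx].
- by move=> /AB[b Bb bx]; exists b; [right|].
- by exists x; [left|exact: ballxx].
- by move=> /BA[b Bb bx]; exists b; [right|].
Qed.

Lemma hausdorff_dist_ge0 A B : 0 <= hausdorff_dist A B.
Proof.
rewrite /hausdorff_dist; set E := [set _ | _].
have [E0|/set0P/negP/negPn/eqP ->] := pselect (E !=set0); last by rewrite inf0.
by apply: lb_le_inf => // e [/ltW].
Qed.

Lemma hausdorff_dist_le (e : R) A B : 0 < e -> hclose e A B -> hausdorff_dist A B <= e.
Proof.
move=> e0 [AB BA]; apply: ge_inf; last by split.
by exists 0 => r [/ltW].
Qed.

(** A bound on the metric and points in both sets supply an admissible radius; with none, the
    infimum would be 0 by convention. *)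
Lemma hausdorff_dist_lt (e : R) A B : compact [set: T] -> A !=set0 -> B !=set0 ->
  hausdorff_dist A B < e -> hclose e A B.
Proof.
move=> cT [a Aa] [b Bb]; have [M M0 TM] := compact_mdist_bounded cT.
move=> /inf_lt[|r [r0 AB BA] re].
  by exists M; split=> // x _; [exists b|exists a] => //; exact/mdist_ballP.
by split=> [x /AB|x /BA] [y Ay yx]; exists y => //; apply: le_ball yx; exact: ltW.
Qed.

(** * Distance to a set and the Whitney map *)

Definition infdist x A : R := inf (mdist x @` A).

Lemma infdist_has_inf x A : A !=set0 -> has_inf (mdist x @` A).
Proof.
move=> [a Aa]; split; first by exists (mdist x a), a.
by exists 0 => _ [y _ <-]; exact: mdist_ge0.
Qed.

Lemma infdist_ge0 x A : A !=set0 -> 0 <= infdist x A.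
Proof.
move=> A0; apply: lb_le_inf; first by case: (infdist_has_inf x A0).
by move=> _ [y _ <-]; exact: mdist_ge0.
Qed.

Lemma infdist_le x A a : A a -> infdist x A <= mdist x a.
Proof.
move=> Aa; apply: ge_inf; last by exists a.
by exists 0 => _ [y _ <-]; exact: mdist_ge0.
Qed.

Lemma infdist_subset x A B : A !=set0 -> A `<=` B -> infdist x B <= infdist x A.
Proof.
move=> A0 AB; apply: lb_le_inf; first by case: (infdist_has_inf x A0).
by move=> _ [y /AB By <-]; exact: infdist_le.
Qed.

Lemma infdist_hclose (e : R) x A B : B !=set0 -> hclose e A B ->
  infdist x A <= infdist x B + e.
Proof.
move=> B0 [_ BA]; rewrite -lerBlDr.
apply: lb_le_inf; first by case: (infdist_has_inf x B0).
move=> _ [y /BA[a Aa /mdist_ballP ay] <-]; rewrite lerBlDr.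
apply: le_trans (infdist_le x Aa) _.
apply: le_trans (metric_triangle _ y _) _.
by rewrite lerD2l metric_sym ltW.
Qed.

Lemma infdist_lt x A B : A !=set0 -> closed A -> B x -> ~ A x ->
  exists2 e : R, 0 < e & forall y, ball x e y -> infdist y B < infdist y A.
Proof.
move=> A0 cA Bx nAx.
have /nbhs_ballP[e /= e0 eA] : nbhs x (~` A).
  by apply: open_nbhs_nbhs; split => //; exact: closed_openC.
(* If [y] is within [e / 3] of [x], a point of [A] within [e / 3] of [y] would lie in the ball of
   radius [e] about [x], which misses [A]. *)
exists (e / 3); first by rewrite divr_gt0.
move=> y xy; apply: le_lt_trans (infdist_le _ Bx) _.
rewrite metric_sym; apply: lt_le_trans (iffLR (mdist_ballP _ _ _) xy) _.
apply: lb_le_inf; first by case: (infdist_has_inf y A0).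
move=> _ [z Az <-]; rewrite leNgt; apply/negP => yz.
apply: (eA z) => //; apply: le_ball (_ : e / 3 + e / 3 <= _) _ _.
  by move: e0; lra.
by apply: (ball_triangle xy); exact/mdist_ballP.
Qed.

(* A Whitney map on the hyperspace: minus a weighted sum of the distances to the
   points of a dense sequence. *)
Lemma whitney_map_exists (x0 : T) : compact [set: T] ->
  exists mu : set T -> R,
    (forall A B (e : R), A !=set0 -> B !=set0 -> hclose e A B -> mu A <= mu B + e) /\
    (forall A B, A !=set0 -> closed A -> A `<` B -> mu A < mu B).
Proof.
move=> cT; have [u uP] := compact_dense_sequence x0 cT.
have [M M0 TM] := compact_mdist_bounded cT.
(* The weights are [2^-(n+1)], with sum 1, so a Hausdorff error [e] changes the weighted sum by at
   most [e]. *)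
pose w : R ^nat := geometric 2^-1 2^-1.
have w0 n : 0 < w n by rewrite /w/= mulr_gt0// exprn_gt0.
have half : `|(2^-1 : R)| < 1 by rewrite ger0_norm// invf_lt1// ltr1n.
have wcvg : series w @ \oo --> (1 : R).
  have := @cvg_geometric_series R 2^-1 2^-1 half.
  by rewrite (_ : 1 - 2^-1 = 2^-1 :> R) ?divff ?invr_eq0//; lra.
pose d A : R ^nat := fun n => w n * infdist (u n) A.
have d0 A : A !=set0 -> forall n, 0 <= d A n.
  by move=> A0 n; rewrite mulr_ge0 ?infdist_ge0// ltW.
have ws (c : R) : series (c *: w) @ \oo --> c.
  rewrite (_ : series _ = fun n => c * series w n).
    by rewrite -[X in _ --> X](mulr1 c); apply: cvgM => //; exact: cvg_cst.
  by apply/funext => n; rewrite /series/= mulr_sumr.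
have dcvg A : A !=set0 -> cvgn (series (d A)).
  move=> A0; have [a Aa] := A0.
  apply: nondecreasing_is_cvgn.
    by apply/nondecreasing_seqP => n; rewrite seriesSr lerDl d0.
  exists M => _ [n _ <-].
  have -> : M = limn (series (M *: w)) by apply/esym/cvg_lim => //; exact: ws.
  apply: (@le_trans _ _ (series (M *: w) n)).
    apply: ler_sum => i _; rewrite /d/= mulrC ler_wpM2r ?ltW//.
    by rewrite (le_lt_trans (infdist_le _ Aa)).
  apply: nondecreasing_cvgn_le; last by apply/cvg_ex; exists M; exact: ws.
  by apply/nondecreasing_seqP => k; rewrite seriesSr lerDl/= mulr_ge0// ltW.
exists (fun A => - limn (series (d A))); split.
- move=> A B e A0 B0 /hclose_sym AB.
  rewrite lerNl opprD opprK.
  suff : limn (series (d B)) <= limn (series (d A + e *: w)).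
    rewrite lim_seriesD; [|exact: dcvg|by apply/cvg_ex; exists e; exact: ws].
    by rewrite (cvg_lim _ (ws e))// lerBlDr.
  apply: lim_series_le => [||n]; first exact: dcvg.
    by apply: is_cvg_seriesD; [exact: dcvg|apply/cvg_ex; exists e; exact: ws].
  have -> : (d A + e *: w) n = w n * (infdist (u n) A + e).
    by rewrite mulrDr [w n * e]mulrC.
  by apply: ler_wpM2l; [exact: ltW|exact: infdist_hclose].
- move=> A B A0 cA [AB /existsNP[x /not_implyP[Bx nAx]]].
  have B0 : B !=set0 by exists x.
  rewrite ltrN2.
  have [e e0 eP] := infdist_lt A0 cA Bx nAx.
  (* A term of the dense sequence near [x] gives a strict inequality at index [n], and no other term
     goes the wrong way. The partial sum up to [n.+1] already contains the strict term. *)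
  have [n /eP un] := uP x e e0.
  rewrite -subr_gt0 -lim_seriesB; [|exact: dcvg|exact: dcvg].
  have dAB k : 0 <= (d A - d B) k.
    rewrite /d/= -mulrBr; apply: mulr_ge0; first exact: ltW.
    by rewrite subr_ge0 infdist_subset.
  apply: (@lt_le_trans _ _ (series (d A - d B) n.+1)).
    rewrite seriesSr ltr_wpDl//; first by apply: sumr_ge0 => *; exact: dAB.
    by rewrite /d/= -mulrBr mulr_gt0// subr_gt0.
  apply: nondecreasing_cvgn_le; last by apply: is_cvg_seriesB; exact: dcvg.
  by apply/nondecreasing_seqP => k; rewrite seriesSr lerDl.
Qed.

End CompactMetric.

(** * Constructing order arcs *)

Section OrderArcs.
Context {R : realType} {T : metricType R}.
Implicit Types (A B C : set T) (x y : T) (alpha beta : R -> set T).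

(** Hausdorff continuity in epsilon-delta form, on any interval, so that paths can be concatenated
    before being rescaled to [[0, 1]]. *)
Definition hcontinuous_on (a b : R) alpha := forall s : R, s \in `[a, b] ->
  forall e : R, 0 < e -> exists2 d : R, 0 < d &
    forall t, t \in `[a, b] -> `|t - s| < d -> hclose e (alpha t) (alpha s).

Lemma order_arc_hcontinuous alpha : compact [set: T] -> order_arc alpha ->
  hcontinuous_on 0 1 alpha.
Proof.
move=> cT [ha ca _] s s01 e e0.
have /cvgrPdist_lt /(_ e e0) := ca s s01.
rewrite near_withinE => /nbhs_ballP[d /= d0 dP]; exists d => // t t01 ts.
have [at0 _] := ha t t01; have [as0 _] := ha s s01.
apply: hausdorff_dist_lt => //.
have /= := dP t _ t01; rewrite sub0r normrN ger0_norm ?hausdorff_dist_ge0//.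
by apply; rewrite /ball/= distrC.
Qed.

Lemma hcontinuous_cvg alpha (s : R) : hcontinuous_on 0 1 alpha -> s \in `[0, 1] ->
  hausdorff_dist (alpha t) (alpha s) @[t --> within `[0, 1] (nbhs s)] --> (0 : R).
Proof.
move=> ca s01; apply/cvgrPdist_lt => e e0.
(* [hclose] yields only a weak bound on the distance; halving [e] makes it strict. *)
have [d d0 dP] := ca s s01 (e / 2) (divr_gt0 e0 (ltr0Sn _ 1)).
rewrite near_withinE; apply/nbhs_ballP; exists d => //= t st t01.
rewrite sub0r normrN ger0_norm ?hausdorff_dist_ge0//.
apply: (@le_lt_trans _ _ (e / 2)); last by move: e0; lra.
apply: hausdorff_dist_le; first by rewrite divr_gt0.
by apply: dP => //; rewrite distrC.
Qed.

(* A Whitney map is strictly monotone along the path except on the intervals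
   where the path is constant, and so serves as the new parameter. *)
Lemma monotone_path_order_arc (a b : R) alpha : compact [set: T] -> a <= b ->
    (forall t, t \in `[a, b] -> hyperspace (alpha t)) ->
    hcontinuous_on a b alpha ->
    (forall s t, a <= s -> s <= t -> t <= b -> alpha s `<=` alpha t) ->
    alpha a <> alpha b ->
  exists tau : R -> R,
    [/\ order_arc (alpha \o tau),
        forall s, s \in `[0, 1] -> tau s \in `[a, b],
        forall s, s \in `[0, 1[ -> tau s < b,
        alpha (tau 0) = alpha a & alpha (tau 1) = alpha b].
Proof.
move=> cT ab ha ca ma neq.
have aab : a \in `[a, b] by rewrite in_itv/= lexx.
have bab : b \in `[a, b] by rewrite in_itv/= lexx ab.
have [[x0 _] _] := ha a aab.
have [mu [muL mulD]] := whitney_map_exists x0 cT.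
pose phi t := mu (alpha t).
have a0 t : t \in `[a, b] -> alpha t !=set0 by move=> /ha[].
have phi_lt s t : s \in `[a, b] -> t \in `[a, b] -> s <= t ->
    alpha s <> alpha t -> phi s < phi t.
  move=> sab tab st ast; apply: mulD; [exact: a0|by have [_] := ha s sab|].
  have sub : alpha s `<=` alpha t.
    by apply: ma => //; [rewrite (itvP sab)|rewrite (itvP tab)].
  by split => // ts; apply: ast; apply/seteqP.
have phi_le s t : s \in `[a, b] -> t \in `[a, b] -> s <= t -> phi s <= phi t.
  move=> sab tab st; have [ast|/phi_lt h] := pselect (alpha s = alpha t).
    by rewrite /phi ast.
  exact/ltW/h.
have phi_inj s t : s \in `[a, b] -> t \in `[a, b] -> phi s = phi t ->
    alpha s = alpha t.
  move=> sab tab pst; apply: contrapT => nst.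
  have [st|/ltW ts] := leP s t.
    by have := phi_lt _ _ sab tab st nst; rewrite pst ltxx.
  by have := phi_lt _ _ tab sab ts (nesym nst); rewrite pst ltxx.
have phi_cont : {within `[a, b], continuous phi}.
  apply/subspace_continuousP => s sab; apply/cvgrPdist_lt => e e0.
  have [d d0 dP] := ca s sab (e / 2) (divr_gt0 e0 (ltr0Sn _ 1)).
  rewrite near_withinE; apply/nbhs_ballP; exists d => //= t st tab.
  have h : hclose (e / 2) (alpha t) (alpha s) by apply: dP => //; rewrite distrC.
  have h' := hclose_sym h.
  have := muL _ _ _ (a0 _ tab) (a0 _ sab) h.
  have := muL _ _ _ (a0 _ sab) (a0 _ tab) h'.
  rewrite -/(phi s) -/(phi t) ltr_norml => h1 h2.
  by rewrite /from_subspace; apply/andP; split; move: e0 h1 h2; lra.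
pose c := phi b - phi a.
have c0 : 0 < c by rewrite subr_gt0; exact: phi_lt.
(* [tau s] is any parameter at which [phi] takes the value a fraction [s] of the way from [phi a] to
   [phi b]. [tau] may jump inside an interval where [alpha] is constant; only the composite with
   [alpha] has to be continuous. *)
have /choice[tau tauP] (s : R) : exists t, s \in `[0, 1] ->
    t \in `[a, b] /\ phi t = phi a + s * c.
  have [s01|ns01] := boolP (s \in `[0, 1]); last by exists 0.
  have s0 : 0 <= s by rewrite (itvP s01).
  have s1 : s <= 1 by rewrite (itvP s01).
  have [|t tab pt] := @IVT R phi a b (phi a + s * c) ab phi_cont; last by exists t.
  rewrite min_l ?max_r ?phi_le//; apply/andP; split.
    by rewrite lerDl mulr_ge0// ltW.
  by rewrite -lerBrDl -/c ler_piMl// ltW.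
have tauab s s01 := (tauP s s01).1.
have phitau s s01 := (tauP s s01).2.
have i0 : (0 : R) \in `[0, 1] by rewrite in_itv/= lexx ler01.
have i1 : (1 : R) \in `[0, 1] by rewrite in_itv/= lexx ler01.
exists tau; split=> //; last 2 first.
- by apply: phi_inj => //; rewrite ?tauab// phitau// mul0r addr0.
- by apply: phi_inj => //; rewrite ?tauab// phitau// mul1r addrC subrK.
- split=> [s s01|s s01|s t s0 st t1].
  + exact/ha/tauab.
  + apply: hcontinuous_cvg => // {s01}s s01 e e0.
    (* [O] is the union of balls, centred on the level set of [phi] through [tau s], on which
       [alpha] varies by at most [e]. The rest [K] of the interval is compact and its image under
       [phi] misses [phi (tau s)], so parameters with nearby values of [phi] lie in [O]. *)
    pose D := [set q : R * R | [/\ q.1 \in `[a, b], phi q.1 = phi (tau s), 0 < q.2 &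
       forall t, t \in `[a, b] -> `|t - q.1| < q.2 -> hclose e (alpha t) (alpha q.1)]].
    pose O := \bigcup_(q in D) ball q.1 q.2.
    have oO : open O by apply: bigcup_open => q [_ _ q0 _]; exact: ball_open.
    pose K := `[a, b]%classic `&` ~` O.
    have cK : compact K.
      by apply: compact_closedI; [exact: segment_compact|exact: open_closedC].
    have clK : closed (phi @` K).
      apply: compact_closed => //; apply: continuous_compact => //.
      by apply: continuous_subspaceW phi_cont => ? [].
    have nK : ~ (phi @` K) (phi (tau s)).
      move=> [t [tab nOt] pt]; apply: nOt.
      have [d d0 dP] := ca t tab e e0.
      by exists (t, d); [split|exact: ballxx].
    have /nbhs_ballP[r /= r0 rP] : nbhs (phi (tau s)) (~` (phi @` K)).
      by apply: open_nbhs_nbhs; split => //; exact: closed_openC.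
    exists (r / c) => [|t t01 ts]; first exact: divr_gt0.
    have nt : ~ K (tau t).
      move=> Kt; apply: (rP (phi (tau t))); last by exists (tau t).
      rewrite /ball/= !phitau// opprD addrACA subrr add0r -mulrBl normrM.
      by rewrite (gtr0_norm c0) -ltr_pdivlMr// distrC.
    have [q [qab qs q0 qP] qt] : O (tau t).
      by apply: contrapT => nO; apply: nt; split => //; exact: tauab.
    rewrite -(phi_inj q.1 (tau s) qab (tauab _ s01) qs).
    by apply: qP; [exact: tauab|rewrite distrC].
  + have s01 : s \in `[0, 1] by rewrite in_itv/= s0 (le_trans (ltW st) t1).
    have t01 : t \in `[0, 1] by rewrite in_itv/= t1 (le_trans s0 (ltW st)).
    have pst : phi (tau s) < phi (tau t).
      by rewrite !phitau// ltrD2l ltr_pM2r.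
    have ltau : tau s <= tau t.
      rewrite leNgt; apply/negP => /ltW /(phi_le _ _ (tauab t t01) (tauab s s01)).
      by rewrite leNgt pst.
    have sub : alpha (tau s) `<=` alpha (tau t).
      apply: ma => //; first by rewrite (itvP (tauab s s01)).
      by rewrite (itvP (tauab t t01)).
    split => // sub'; have e : alpha (tau s) = alpha (tau t) by apply/seteqP.
    by move: pst; rewrite /phi e ltxx.
- move=> s; rewrite in_itv/= => /andP[s0 s1].
  have s01 : s \in `[0, 1] by rewrite in_itv/= s0 ltW.
  rewrite lt_neqAle (itvP (tauab s s01)) andbT; apply/eqP => tb.
  have := phitau s s01; rewrite tb => /eqP; rewrite -subr_eq0 opprD addrA -/c.
  by rewrite -[X in X - _]mul1r -mulrBl mulf_eq0 subr_eq0 (gt_eqF c0) gt_eqF.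
Qed.

End OrderArcs.

(** * Concatenating a path of points with an order arc *)

Section Paths.
Context {R : realType} {T : metricType R}.
Implicit Types (A B C : set T) (x y : T) (alpha beta : R -> set T) (f : R -> T).

Lemma hcontinuous_glue (a b c : R) alpha beta : a <= b -> b <= c ->
    hcontinuous_on a b alpha -> hcontinuous_on b c beta -> alpha b = beta b ->
  hcontinuous_on a c (fun t => if t <= b then alpha t else beta t).
Proof.
move=> ab bc ca cb e s; rewrite in_itv/= => /andP[as_ sc] r r0.
have [sb|bs|sb] := ltgtP s b.
- have sab : s \in `[a, b] by rewrite in_itv/= as_ ltW.
  have [d d0 dP] := ca s sab r r0.
  exists (Num.min d (b - s)) => [|t]; first by rewrite lt_min d0 subr_gt0.
  rewrite in_itv/= lt_min => /andP[at_ tc] /andP[td tb].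
  have {}tb : t <= b by move: tb; rewrite ltr_norml => /andP[_]; lra.
  by rewrite tb; apply: dP => //; rewrite in_itv/= at_.
- have sbc : s \in `[b, c] by rewrite in_itv/= sc ltW.
  have [d d0 dP] := cb s sbc r r0.
  exists (Num.min d (s - b)) => [|t]; first by rewrite lt_min d0 subr_gt0.
  rewrite in_itv/= lt_min => /andP[at_ tc] /andP[td tb].
  have {}tb : b < t by move: tb; rewrite ltr_norml => /andP[+ _]; lra.
  by rewrite leNgt tb/=; apply: dP => //; rewrite in_itv/= tc ltW.
- subst s.
  have [|d d0 dP] := ca b _ r r0; first by rewrite in_itv/= ab lexx.
  have [|d' d'0 d'P] := cb b _ r r0; first by rewrite in_itv/= bc lexx.
  exists (Num.min d d') => [|t]; first by rewrite lt_min d0.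
  rewrite in_itv/= lt_min => /andP[at_ tc] /andP[td td'].
  have [tb|bt] := leP t b; first by apply: dP => //; rewrite in_itv/= at_.
  by rewrite e; apply: d'P => //; rewrite in_itv/= tc ltW.
Qed.

(** A point of the longer segment outside the shorter one is matched with the end point of the
    shorter one; both have parameters close to [s]. *)
Lemma hcontinuous_initial_segments f : {within `[0, 1], continuous f} ->
  hcontinuous_on 0 1 (fun t => f @` `[0, t]).
Proof.
move=> /subspace_continuousP cf s s01 e e0.
have e20 : 0 < e / 2 by rewrite divr_gt0.
have ee : e / 2 <= e by move: e0; lra.
have : \forall t \near within `[0, 1] (nbhs s), ball (f s) (e / 2) (f t).
  by apply: (cf s s01); exact: nbhsx_ballx.
rewrite near_withinE => /nbhs_ballP[d /= d0 dP].
have {}dP v : v \in `[0, 1] -> `|v - s| < d -> ball (f s) (e / 2) (f v).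
  by move=> v01 vs; apply: (dP v) => //; rewrite /ball/= distrC.
exists d => // t t01 ts; split=> _ [v /= v0 <-]; move: v0; rewrite in_itv/= => /andP[v0 vt].
- have [vs|sv] := leP v s.
    by exists (f v); [exists v => //=; rewrite in_itv/= v0|exact: ballxx].
  exists (f s); first by exists s => //=; rewrite in_itv/= lexx (itvP s01).
  apply: (le_ball ee); apply: dP.
    by rewrite in_itv/= v0 (le_trans vt)// (itvP t01).
  by move: ts; rewrite !ltr_norml => /andP[? ?]; apply/andP; split; lra.
- have [vs|sv] := leP v t.
    by exists (f v); [exists v => //=; rewrite in_itv/= v0|exact: ballxx].
  exists (f t); first by exists t => //=; rewrite in_itv/= lexx (itvP t01).
  rewrite [e]splitr; apply: (@ball_triangle _ _ (f s)).
    by apply/ball_sym/dP.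
  apply: dP; first by rewrite in_itv/= v0 (le_trans vt)// (itvP s01).
  by move: ts; rewrite !ltr_norml => /andP[? ?]; apply/andP; split; lra.
Qed.

Lemma within_path_continuum f (a b : R) : 0 <= a -> a <= b -> b <= 1 ->
  {within `[0, 1], continuous f} -> continuum (f @` `[a, b]).
Proof.
move=> a0 ab b1 cf.
have cf' : {within `[a, b], continuous f}.
  apply: continuous_subspaceW cf => t /=; rewrite !in_itv/= => /andP[at_ tb].
  by rewrite (le_trans a0)//= (le_trans tb).
split.
- by exists (f a), a => //=; rewrite in_itv/= lexx.
- by apply: continuous_compact => //; exact: segment_compact.
- by apply: connected_continuous_connected => //; exact: segment_connected.
Qed.

(** First the initial segments of the path grow to its whole image [P]; then [P] is joined with the
    sets of [beta]. The result is monotone on [[0, 2]], perhaps not strictly, and a change of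
    parameter turns it into an order arc. *)
Lemma order_arc_prepend_path f beta C : compact [set: T] ->
    {within `[0, 1], continuous f} -> C !=set0 ->
    f @` `[0, 1] `&` C = set0 ->
    order_arc beta -> (forall t, t \in `[0, 1] -> connected_hyperspace (beta t)) ->
    beta 0 = [set f 1] -> beta 1 = setT ->
    (forall t, t \in `[0, 1[ -> beta t `&` C = set0) ->
  exists alpha, [/\ order_arc alpha,
    forall t, t \in `[0, 1] -> connected_hyperspace (alpha t),
    alpha 0 = [set f 0], alpha 1 = setT &
    forall t, t \in `[0, 1[ -> alpha t `&` C = set0].
Proof.
move=> cT cf [z Cz] fC ob cb b0 b1 bC.
pose P := f @` `[0, 1].
pose F t := f @` `[0, t].
pose G t := P `|` beta (t - 1).
have i2 (t : R) : t \in `[0, 2] -> ~~ (t <= 1) -> t - 1 \in `[0, 1].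
  by rewrite !in_itv/= -ltNge => /andP[t0 t2] t1; apply/andP; split; lra.
have Pf1 : P (f 1) by exists 1 => //=; rewrite in_itv/= ler01 lexx.
have F0 : F 0 = [set f 0].
  apply/seteqP; split=> [_ [t /= t0 <-]|_ ->].
    by congr f; apply/eqP; rewrite eq_le !(itvP t0).
  by exists 0 => //=; rewrite in_itv/= lexx.
have P0 : P (f 0) by exists 0 => //=; rewrite in_itv/= ler01 lexx.
have nz : ~ P z by move=> Pz; have : (P `&` C) z by []; rewrite fC.
have compP : continuum P by exact: within_path_continuum.
have clos A : compact A -> closed A by apply: compact_closed; exact: metric_hausdorff.
have bm s t : 0 <= s -> s <= t -> t <= 1 -> beta s `<=` beta t.
  move=> s0; rewrite le_eqVlt => /orP[/eqP -> _ //|st t1].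
  by case: ob => _ _ /(_ s t s0 st t1) [].
pose alpha t := if t <= 1 then F t else G t.
have ch t : t \in `[0, 2] -> connected_hyperspace (alpha t).
  move=> t2; rewrite /alpha; case: ifPn => t1.
    have [] := @within_path_continuum f 0 t (lexx _) _ t1 cf; first by rewrite (itvP t2).
    by move=> ? ? ?; split => //; split => //; exact: clos.
  have [[b'0 clb] cnb] := cb _ (i2 _ t2 t1).
  case: compP => _ cP cnP; split; [split|].
  - by exists (f 0); left.
  - by apply: closedU => //; exact: clos.
  - apply: connectedU => //; exists (f 1); split => //.
    apply: (bm 0); [by []|by move: (i2 _ t2 t1) => h; rewrite (itvP h)..|].
    by rewrite b0.
have ha t : t \in `[0, 2] -> hyperspace (alpha t) by move=> /ch[].
have a0 : alpha 0 = [set f 0] by rewrite /alpha ler01.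
have a2 : alpha 2 = setT.
  rewrite /alpha (_ : 2 <= 1 = false); last by lra.
  by rewrite /G (_ : 2 - 1 = 1 :> R) ?b1 ?setUT//; lra.
have hc : hcontinuous_on 0 2 alpha.
  apply: hcontinuous_glue; [exact: ler01|by lra| | |].
  - exact: hcontinuous_initial_segments.
  - move=> s s12 e e0.
    have s01 : s - 1 \in `[0, 1].
      by move: s12; rewrite !in_itv/= => /andP[? ?]; apply/andP; split; lra.
    have [d d0 dP] := order_arc_hcontinuous cT ob s01 e0.
    exists d => // t t12 ts; apply: hcloseU => //; apply: dP.
      by move: t12; rewrite !in_itv/= => /andP[? ?]; apply/andP; split; lra.
    by rewrite opprB addrA subrK.
  - by rewrite /G subrr b0; apply/esym/setUidPl => _ ->.
have ma s t : 0 <= s -> s <= t -> t <= 2 -> alpha s `<=` alpha t.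
  move=> s0 st t2; rewrite /alpha; have [t1|t1] := leP t 1.
    rewrite (le_trans st t1) => _ [v /= vs <-]; exists v => //=.
    by move: vs; rewrite !in_itv/= => /andP[-> vs]/=; exact: le_trans st.
  have [s1|s1] := leP s 1.
    move=> _ [v /= vs <-]; left; exists v => //=.
    by move: vs; rewrite !in_itv/= => /andP[-> vs]/=; exact: le_trans s1.
  by apply: setUS; apply: bm; lra.
have aC t : 0 <= t -> t < 2 -> alpha t `&` C = set0.
  move=> t0 t2; rewrite /alpha; apply/seteqP; split => // u [].
  have [t1|t1] := leP t 1.
    move=> [v /= vs <-] Cv; suff : (P `&` C) (f v) by rewrite fC.
    split => //; exists v => //=.
    by move: vs; rewrite !in_itv/= => /andP[-> vs]/=; exact: le_trans t1.
  move=> [Pu|bu] Cu; first by suff : (P `&` C) u by rewrite fC.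
  suff : (beta (t - 1) `&` C) u by rewrite bC// in_itv/=; apply/andP; split; lra.
  by [].
(* The path is not constant: a point [z] of [C] lies outside [P], hence differs from [f 0]. *)
have [|tau [ot t01 tlt t0 t1]] := monotone_path_order_arc cT (ler0n R 2) ha hc ma.
  rewrite a0 a2 => fT; apply: nz; have : [set f 0] z by rewrite fT.
  by move=> ->.
exists (alpha \o tau); split => //.
- by move=> t /t01/ch.
- by rewrite /= t0.
- by rewrite /= t1.
- move=> t /[dup] /tlt tt; rewrite in_itv/= => /andP[h0 h1]; apply: aC => //.
  have /t01 ttt : t \in `[0, 1] by rewrite in_itv/= h0 ltW.
  by rewrite (itvP ttt).
Qed.

End Paths.

(** * Nonblockers of a dendroid *)

Section Dendroids.
Context {R : realType} {T : metricType R}.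
Implicit Types (A B C K L : set T) (x y a p : T).

Lemma compact_metric_closed A : compact A -> closed A.
Proof. by apply: compact_closed; exact: metric_hausdorff. Qed.

Lemma continuumU K L : continuum K -> continuum L -> K `&` L !=set0 ->
  continuum (K `|` L).
Proof.
move=> [[x Kx] cK nK] [_ cL nL] KL; split; first by exists x; left.
- exact: compactU.
- exact: connectedU.
Qed.

(** When [K] and [L] meet, their union is a continuum, and its unicoherence applies. *)
Lemma dendroid_connectedI K L : dendroid [set: T] -> continuum K -> continuum L ->
  connected (K `&` L).
Proof.
move=> [_ _ hu] cK cL; have [KL|/set0P/negP/negPn/eqP ->] := pselect (K `&` L !=set0).
  by apply: (hu (K `|` L)) => //; exact: continuumU.
exact: connected0.
Qed.

Lemma nonblocker_continuum p A x : compact [set: T] -> ~ shore_set [set p] ->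
    nonblocker A -> ~ A x ->
  exists K, [/\ continuum K, K x, K p & K `&` A = set0].
Proof.
move=> cT np [_ _ nA] /nA [alpha [oa ca a0 a1 aA]].
have i1 : (1 : R) \in `[0, 1] by rewrite in_itv/= lexx ler01.
have i0 : (0 : R) \in `[0, 1[ by rewrite in_itv/= lexx ltr01.
have sub t : t \in `[0, 1[ -> (t : R) \in `[0, 1].
  by rewrite !in_itv/= => /andP[-> /ltW].
have [[t [t01 tp]]|nt] := pselect (exists t : R, t \in `[0, 1[%R /\ alpha t p).
  have t01' := sub _ t01.
  have [[_ clt] cnt] := ca t t01'.
  exists (alpha t); split=> //; last exact: aA.
    by split=> //; [exists p|exact: (subclosed_compact _ cT)].
  move: t01'; rewrite in_itv/= le_eqVlt => /andP[/orP[/eqP <-|t0] t1]; first by rewrite a0.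
  by case: oa => _ _ /(_ 0 t (lexx _) t0 t1)[+ _]; apply; rewrite a0.
exfalso; apply: np; split.
- by split; [exists p|apply: compact_metric_closed; exact: compact_set1].
(* Were [{p}] the whole space, [x] would be [p] and [alpha 0] would already contain [p]. *)
- move=> pT; apply: nt; exists 0; split => //; rewrite a0.
  by have : [set p] x by [rewrite pT]; move=> ->.
move=> e e0.
have [d d0 dP] := order_arc_hcontinuous cT oa i1 (divr_gt0 e0 (ltr0Sn R 1)).
(* A parameter below 1 and within [d] of it; the minimum with 1 keeps it nonnegative. *)
pose t := 1 - Num.min d 1 / 2.
have m0 : 0 < Num.min d 1 by rewrite lt_min d0 ltr01.
have m1 : Num.min d 1 <= 1 by rewrite ge_min lexx orbT.
have md : Num.min d 1 <= d by rewrite ge_min lexx.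
have t01 : t \in `[0, 1[ by rewrite in_itv/= /t; apply/andP; split; lra.
exists (alpha t); split; first exact/ca/sub.
- apply: (@le_lt_trans _ _ (e / 2)); last by move: e0; lra.
  apply: hausdorff_dist_le; first by rewrite divr_gt0.
  rewrite -a1; apply: dP; first exact: sub.
  by rewrite /t addrAC subrr add0r normrN gtr0_norm ?divr_gt0//; lra.
- apply/seteqP; split => // y [ay yp]; apply: nt; exists t; split => //.
  by rewrite -yp.
Qed.

Lemma nonblocker_notin p A : compact [set: T] -> ~ shore_set [set p] ->
  nonblocker A -> ~ A p.
Proof.
move=> cT np nA Ap; have [x nAx] : exists x, ~ A x.
  by apply/existsNP => h; case: nA => _ + _; apply; apply/seteqP; split.
have [K [_ _ Kp KA]] := nonblocker_continuum cT np nA nAx.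
by have : (K `&` A) p by []; rewrite KA.
Qed.

Lemma connected_nonblocker_first_point p A : dendroid [set: T] ->
    ~ shore_set [set p] -> nonblocker A -> connected A ->
  exists2 a, A a & forall B, nonblocker B -> B a -> A `<=` B.
Proof.
move=> dT np nA cA; have [[_ cT _] arcT _] := dT.
have nAp := nonblocker_notin cT np nA.
have [[[y Ay] clA] _ _] := nA.
have contA : continuum A by split => //; [exists y|exact: (subclosed_compact _ cT)].
have [|L [f [g [[cf cg] fL fg f0 f1]] _]] := arcT p y I I.
  by move=> py; apply: nAp; rewrite py.
have cL : compact L by rewrite -fL; apply: continuous_compact => //; exact: segment_compact.
(* The first point of [A] on the arc is where the inverse parametrization [g] is least on the
   compact set of common points. *)
have [||| a /set_mem[Aa La] amin] := @compact_EVT_min T R g (A `&` L).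
- by exists y; split => //; rewrite -fL -f1; exists 1 => //=; rewrite in_itv/= ler01 lexx.
- by rewrite setIC; exact: compact_closedI.
- by apply: continuous_subspaceW cg => ? [].
move: (La); rewrite -fL => -[s /= s01 fs].
have gs : g a = s by rewrite -fs fg// inE.
pose P := f @` `[0, s].
have contP : continuum P.
  by apply: within_path_continuum => //; rewrite (itvP s01).
have PA z : P z -> A z -> z = a.
  move=> [t /= t0s ft] Az; have t01 : t \in `[0, 1].
    by rewrite in_itv/= (itvP t0s)/= (le_trans (_ : t <= s)) ?(itvP t0s)// (itvP s01).
  have : g a <= g z.
    by apply: amin; apply/mem_set; split => //; rewrite -fL; exists t.
  rewrite -ft fg ?inE// gs => st; rewrite -fs; congr f.
  by apply/eqP; rewrite eq_le st (itvP t0s).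
have Pa : P a by exists s => //=; rewrite in_itv/= lexx (itvP s01).
have Pp : P p by exists 0 => //=; rewrite in_itv/= lexx (itvP s01).
exists a => // B nB Ba z Az; apply: contrapT => nBz.
have [K [contK Kz Kp KB]] := nonblocker_continuum cT np nB nBz.
have nKa : ~ K a by move=> Ka; have : (K `&` B) a by []; rewrite KB.
have contKP : continuum (K `|` P) by apply: continuumU => //; exists p.
have := dendroid_connectedI dT contKP contA.
have clKA : closed (K `&` A).
  by apply: closedI => //; apply: compact_metric_closed; case: contK.
have cla : closed [set a] by apply: compact_metric_closed; exact: compact_set1.
have sep : separated (K `&` A) [set a].
  rewrite /separated -!(closure_id _).1//.
  by split; apply/seteqP; split => // u [[Ku _]] ua; apply: nKa; rewrite -ua.
(* The connected set would lie in one of the two separated parts. It contains [a], which is not in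
   [K], and [z], which differs from [a] since [B] contains only [a] of the two. *)
move=> /(connected_subset sep)[|h|h].
- by move=> u [[Ku|Pu] Au]; [left|right; exact: PA].
- by have [] := h a (conj (or_intror Pa) Aa).
- by apply: nBz; rewrite (h z (conj (or_introl Kz) Az)).
Qed.

(** If the arc met the component at [c = f s], its segment from [x] to [c] would lie in [A] and put
    [x] in the component. For if [f t] is outside [A] with [t <= s], a continuum [K] from [f t] to
    [p] missing [A] must contain the arc from [f t] to [p], and with it [c]. *)
Lemma arc_avoids_component p A a x : dendroid [set: T] -> ~ shore_set [set p] ->
    nonblocker A -> A x -> ~ connected_component A a x ->
  exists2 f : R -> T, {within `[0, 1], continuous f} &
    [/\ f 0 = x, f 1 = p & f @` `[0, 1] `&` connected_component A a = set0].
Proof.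
move=> dT np nA Ax nCx; have [[_ cT _] arcT _] := dT.
have nAp := nonblocker_notin cT np nA.
have [|L [f [g [[cf cg] fL fg f0 f1]] _]] := arcT x p I I.
  by move=> xp; apply: nAp; rewrite -xp.
exists f => //; split => //; apply/seteqP; split => // c [[s /= s01 fs] Cc].
have Ac := connected_component_sub Cc.
apply: nCx; apply: connected_component_trans Cc _.
have /andP[s0 s1] : 0 <= s <= 1 by rewrite !(itvP s01).
exists (f @` `[0, s]); last by exists 0 => //=; rewrite in_itv/= lexx.
split.
- by exists s => //=; rewrite in_itv/= lexx s0.
- move=> _ [t /= t0s <-]; apply: contrapT => nAft.
  have /andP[t0 ts] : 0 <= t <= s by rewrite !(itvP t0s).
  have t1 := le_trans ts s1.
  have [K [contK Kft Kp KA]] := nonblocker_continuum cT np nA nAft.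
  have contM : continuum (f @` `[t, 1]) by exact: within_path_continuum.
  have cKM := dendroid_connectedI dT contK contM.
  have itv1 u : u \in `[t, 1] -> u \in `[0, 1].
    by rewrite !in_itv/= => /andP[tu ->]; rewrite (le_trans t0).
  have cgKM : {within K `&` f @` `[t, 1], continuous g}.
    apply: continuous_subspaceW cg => _ [_ [u /= /itv1 u01 <-]].
    by rewrite -fL; exists u.
  (* Carried over to the parameters by [g], the connected intersection becomes an interval
     containing [t] and 1, hence [s]. *)
  have /connected_intervalP int := connected_continuous_connected cKM cgKM.
  have gt : (g @` (K `&` f @` `[t, 1])) t.
    exists (f t); last by rewrite fg ?inE//; apply: itv1; rewrite in_itv/= lexx t1.
    by split => //; exists t => //=; rewrite in_itv/= lexx.
  have g1 : (g @` (K `&` f @` `[t, 1])) 1.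
    exists (f 1); last by rewrite fg ?inE//; apply: itv1; rewrite in_itv/= lexx t1.
    by split; [rewrite f1|exists 1 => //=; rewrite in_itv/= lexx t1].
  have [|y [Ky [u /= /itv1 u01 fu]] gy] := int t 1 gt g1 s; first by rewrite ts.
  have us : u = s by rewrite -(fg u) ?inE// fu.
  suff : (K `&` A) c by rewrite KA.
  by split => //; rewrite -fs -us fu.
- by case: (within_path_continuum (lexx _) s0 s1 cf).
Qed.

(** Outside [A] the order arcs of [A] still serve. From a point of [A] outside the component, an arc
    to [p] avoiding the component is continued by an order arc from [{p}] given by [A]. *)
Lemma nonblocker_component p A a : dendroid [set: T] -> ~ shore_set [set p] ->
  nonblocker A -> A a -> nonblocker (connected_component A a).
Proof.
move=> dT np nA Aa; have [[_ cT _] _ _] := dT.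
have nAp := nonblocker_notin cT np nA.
have CA := @connected_component_sub _ A a.
have Ca : connected_component A a a by exact: connected_component_refl.
have [[_ clA] _ arcA] := nA.
have miss alpha (t : R) : alpha t `&` A = set0 -> alpha t `&` connected_component A a = set0.
  by move=> h; apply/seteqP; split => // u [au /CA Au]; rewrite -h.
split.
- by split; [exists a|exact: component_closed].
- by move=> CT; apply: nAp; apply: CA; rewrite CT.
move=> x nCx; have [Ax|/arcA[alpha [oa ca a0 a1 aA]]] := pselect (A x); last first.
  by exists alpha; split => // t /aA/miss.
have [f cf [f0 f1 fC]] := arc_avoids_component dT np nA Ax nCx.
have [beta [ob cb b0 b1 bA]] := arcA p nAp.
rewrite -f0; apply: (order_arc_prepend_path cT cf _ fC ob cb) => //.
- by exists a.
- by rewrite f1.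
- by move=> t /bA/miss.
Qed.

(** * The hulls [nb_hull a] *)

Lemma nb_hullE a : (exists A, nonblocker A /\ A a) ->
  nb_hull a = \bigcap_(A in [set A | nonblocker A /\ A a]) A.
Proof. by rewrite /nb_hull; case: asboolP. Qed.

Lemma nb_hull_sub a A : nonblocker A -> A a -> nb_hull a `<=` A.
Proof. by move=> nA Aa; rewrite nb_hullE; [apply: bigcap_inf|exists A]. Qed.

Lemma nb_hull_id a : nb_hull a a.
Proof. by rewrite /nb_hull; case: asboolP => // _ A []. Qed.

(** A point outside the intersection is outside some member [B], and an order arc avoiding [B]
    avoids the smaller intersection. *)
Lemma nonblocker_nb_hull a : (exists A, nonblocker A /\ A a) ->
  nonblocker (nb_hull a).
Proof.
move=> hA; have [A [nA Aa]] := hA; split.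
- split; first by exists a; exact: nb_hull_id.
  by rewrite nb_hullE//; apply: closed_bigI => B [[[]]].
- have [_ AT _] := nA; move=> hT; apply: AT; apply/seteqP; split => // x _.
  by apply: nb_hull_sub nA Aa _ _; rewrite hT.
- move=> x; rewrite {1}nb_hullE// => /existsNP[B /not_implyP[[nB Ba] nBx]].
  have [_ _ /(_ x nBx)[alpha [oa ca a0 a1 aB]]] := nB.
  exists alpha; split => // t /aB h; apply/seteqP; split => // u [au].
  by move=> /(nb_hull_sub nB Ba) Bu; rewrite -h.
Qed.

Lemma connected_nb_hull p a : dendroid [set: T] -> ~ shore_set [set p] ->
  (exists A, nonblocker A /\ A a) -> connected (nb_hull a).
Proof.
move=> dT np /nonblocker_nb_hull nh; have ha := nb_hull_id a.
suff <- : connected_component (nb_hull a) a = nb_hull a by exact: component_connected.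
apply/seteqP; split; first exact: connected_component_sub.
apply: nb_hull_sub; last exact: connected_component_refl.
exact: nonblocker_component np nh ha.
Qed.

End Dendroids.

(** * Comparison of the hulls with the connected nonblockers and the whole space *)

Theorem theorem4p5 (R : realType) (T : metricType R)
    (hX : dendroid [set: T])
    (hp : exists p : T, ~ shore_set [set p]) :
  Lambda T = CNB T `|` [set [set: T]].
Proof.
have [p np] := hp; have [[_ cT _] _ _] := hX.
apply/seteqP; split=> [_ [a _ <-]|A [[nA cA]|->]].
- have [ha|na] := pselect (exists A, nonblocker A /\ A a).
    by left; split; [exact: nonblocker_nb_hull|exact: connected_nb_hull np ha].
  by right; rewrite /nb_hull asboolF.
- have [a Aa aP] := connected_nonblocker_first_point hX np nA cA.
  exists a => //; apply/seteqP; split; first exact: nb_hull_sub.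
  (* The hull of [a] is itself a nonblocker containing [a], so the choice of [a] places [A] inside
     it. *)
  by apply: aP; [apply: nonblocker_nb_hull; exists A|exact: nb_hull_id].
- exists p => //; rewrite /nb_hull asboolF// => -[B [nB]].
  exact: nonblocker_notin np nB.
Qed.
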